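(* Let $Y$ be a compact metric space with Borel $\sigma$-algebra $\mathcal B_Y$, let $\mathcal M(Y)$ be the set of Borel probability measures on $Y$, and let $\Pi\in{}^*\mathcal M(Y)$. Let $\Pi_p$ be the push-down of $\Pi$. Then ${}^*W(\Pi,{}^*\Pi_p)\approx0$, i.e. the *Wasserstein distance between $\Pi$ and the nonstandard extension ${}^*\Pi_p$ of its push-down is infinitesimal.
   Context: We work in a sufficiently saturated nonstandard extension ${}^*$ in the sense of Robinson's nonstandard analysis. $a\approx b$ means that $a-b$ is infinitesimal. For $Y$ compact Hausdorff, every point of ${}^*Y$ is near-standard and $\mathsf{st}:{}^*Y\to Y$ is the standard part map. Each $\Pi\in{}^*\mathcal M(Y)$ is an internal probability measure on $({}^*Y,{}^*\mathcal B_Y)$; $\overline{\Pi}$ denotes its Loeb measure, i.e. the completion of the unique countably additive extension of the standard part of $\Pi$ to the $\sigma$-algebra generated by ${}^*\mathcal B_Y$. The push-down of $\Pi$ is $\Pi_p(C)=\overline{\Pi}(\mathsf{st}^{-1}(C))$, for $C\subseteq Y$ with $\mathsf{st}^{-1}(C)$ Loeb measurable; when $Y$ is compact it is (the completion of) a regular Borel probability measure on $Y$, and we regard $\Pi_p\in\mathcal M(Y)$. $W$ is the Wasserstein metric $W(\mu,\nu)=\inf_\kappa\int d(x,y)\,\kappa(dx,dy)$ over couplings $\kappa$ of $\mu,\nu$ on $Y\times Y$ (equivalently $\sup\{|\int f\,d\mu-\int f\,d\nu|:f\ \text{1-Lipschitz}\}$), and ${}^*W$ is its nonstandard extension. *)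

(* Defs.v *)
From HB Require Import structures.
From mathcomp Require Import all_boot all_order all_algebra.
From mathcomp Require Import ring finmap.
From mathcomp Require Import all_classical all_reals all_analysis.
From mathcomp Require Import measurable_realfun.

Set Implicit Arguments.
Unset Strict Implicit.
Unset Printing Implicit Defensive.
Import Order.TTheory GRing.Theory Num.Theory.
Import numFieldNormedType.Exports.
Local Open Scope classical_set_scope.
Local Open Scope ring_scope.

(* A nonstandard extension is presented as an elementary extension of the full
   universe of types with function application.  The language has one sort per
   type, a constant for every standard object, function application, and
   equality as its only relation.  [Prop] is a sort, so [r x y] is expressed
   by [r x y = True]; [set X] is a sort, so quantifying over sets is
   first-order and reads as quantification over internal sets in the
   extension.  Variables are typed de Bruijn indices in a sequence of sorts. *)

Inductive var : seq Type -> Type -> Type :=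
| V0 G X : var (X :: G) X
| VS G X Z : var G X -> var (Z :: G) X.

Inductive term (G : seq Type) : Type -> Type :=
| Var X : var G X -> term G X
| Cst X : X -> term G X
| App X Z : term G (X -> Z) -> term G X -> term G Z.

Inductive formula (G : seq Type) : Type :=
| Eq X : term G X -> term G X -> formula G
| Not : formula G -> formula G
| And : formula G -> formula G -> formula G
| Or : formula G -> formula G -> formula G
| Imp : formula G -> formula G -> formula G
| All X : formula (X :: G) -> formula G
| Ex X : formula (X :: G) -> formula G.

Record interpretation := Interpretation {
  dom : Type -> Type;
  icst : forall X, X -> dom X;
  app : forall X Z, dom (X -> Z) -> dom X -> dom Z }.

Section satisfaction.
Variable S : interpretation.

Fixpoint env (G : seq Type) : Type :=
  if G is X :: G' then (dom S X * env G')%type else unit.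

Fixpoint var_eval G X (v : var G X) : env G -> dom S X :=
  match v in var G X return env G -> dom S X with
  | V0 _ _ => fun e => e.1
  | VS _ _ _ v' => fun e => var_eval v' e.2
  end.

Fixpoint term_eval G X (t : term G X) (e : env G) : dom S X :=
  match t in term _ X return dom S X with
  | Var _ v => var_eval v e
  | Cst _ x => icst S x
  | App _ _ f u => app (term_eval f e) (term_eval u e)
  end.

Fixpoint sat G (phi : formula G) : env G -> Prop :=
  match phi with
  | Eq _ t u => fun e => term_eval t e = term_eval u e
  | Not f => fun e => ~ sat f e
  | And f g => fun e => sat f e /\ sat g e
  | Or f g => fun e => sat f e \/ sat g e
  | Imp f g => fun e => sat f e -> sat g e
  | All X f => fun e => forall x : dom S X, @sat (X :: G) f (x, e)
  | Ex X f => fun e => exists x : dom S X, @sat (X :: G) f (x, e)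
  end.

End satisfaction.

Definition standard : interpretation :=
  @Interpretation id (fun X x => x) (fun X Z f x => f x).

(* membership in the internal set denoted by [A : *(set X)] *)
Definition intern (S : interpretation) X (A : dom S (set X)) (x : dom S X) :
  Prop := app A x = icst S True.

(* Countable saturation is what the Loeb construction requires; richer
   extensions are special cases. *)
Record nonstandard_extension := NonstandardExtension {
  interpretation_of :> interpretation;
  transfer : forall phi : formula [::],
    @sat standard [::] phi tt <-> @sat interpretation_of [::] phi tt;
  saturation : forall (X : Type) (A : nat -> dom interpretation_of (set X)),
    (forall n, exists x, forall i, (i <= n)%N -> intern (A i) x) ->
    exists x, forall i, intern (A i) x }.

(* [star N X] is [*X], [emb N x] is [*x], and [star1 f], [star2 f] are the
   extensions [*f] of unary and (curried) binary functions. *)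
Definition star (N : nonstandard_extension) (X : Type) : Type := dom N X.

Definition emb (N : nonstandard_extension) X (x : X) : star N X := icst N x.
Arguments emb N {X} x.

HB.instance Definition _ N X := gen_eqMixin (star N X).
HB.instance Definition _ N X := gen_choiceMixin (star N X).
HB.instance Definition _ N (X : pointedType) :=
  isPointed.Build (star N X) (emb N point).

Definition holds (N : nonstandard_extension) (p : star N Prop) : Prop :=
  p = emb N True.

Definition star1 (N : nonstandard_extension) X Z (f : X -> Z)
  (x : star N X) : star N Z := app (emb N f) x.

Definition star2 (N : nonstandard_extension) X Z T (f : X -> Z -> T)
  (x : star N X) (z : star N Z) : star N T := app (app (emb N f) x) z.

Section transfer_lemmas.
Variable N : nonstandard_extension.

Let Hd G (t : term G Prop) : formula G := Eq t (Cst G True).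
Let c G X (x : X) : term G X := Cst G x.
Let f1 G X Z (f : X -> Z) (t : term G X) : term G Z := App (Cst G f) t.
Let f2 G X Z T (f : X -> Z -> T) (t : term G X) (u : term G Z) : term G T :=
  App (App (Cst G f) t) u.
Let v0 X G : term (X :: G) X := Var (@V0 G X).
Let v1 X Y G : term (Y :: X :: G) X := Var (VS Y (@V0 G X)).
Let v2 X Y Z G : term (Z :: Y :: X :: G) X := Var (VS Z (VS Y (@V0 G X))).

Lemma internE X (A : star N (set X)) x : intern A x = holds (app A x).
Proof. by []. Qed.

Lemma PT (P : Prop) : (P = True) = P.
Proof. by rewrite propeqE; split => [->|/propT]. Qed.

Lemma intern_ext X (A B : star N (set X)) :
  (forall x, intern A x <-> intern B x) -> A = B.
Proof.
have := (transfer N (All (All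
   (Imp (All (And (Imp (Hd (App (v2 (set X) (set X) X [::]) (v0 _ _)))
                        (Hd (App (v1 (set X) X _) (v0 _ _))))
                  (Imp (Hd (App (v1 (set X) X _) (v0 _ _)))
                       (Hd (App (v2 (set X) (set X) X [::]) (v0 _ _))))))
     (Eq (v1 _ _ _) (v0 (set X) _)))))).1.
move=> /= T AB; apply: T => [A1 B1 H|x].
  apply/seteqP; split => x; have := H x; rewrite !PT => -[]//.
by have [] := AB x.
Qed.

Lemma intern0 X x : ~ intern (emb N (@set0 X)) x.
Proof.
have := (transfer N (All (Not (Hd (f1 (@set0 X) (v0 X [::])))))).1.
by apply => /= y; rewrite PT.
Qed.

Lemma internT X x : intern (emb N [set: X]) x.
Proof.
have := (transfer N (All (Hd (f1 [set: X] (v0 X [::]))))).1.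
by apply => /= y; rewrite PT.
Qed.

Lemma internC X (A : star N (set X)) x : intern (star1 setC A) x <-> ~ intern A x.
Proof.
have := (transfer N (All (All
 (And (Imp (Hd (App (f1 setC (v1 (set X) X [::])) (v0 _ _)))
           (Not (Hd (App (v1 (set X) X [::]) (v0 _ _)))))
      (Imp (Not (Hd (App (v1 (set X) X [::]) (v0 _ _))))
        (Hd (App (f1 setC (v1 (set X) X [::])) (v0 _ _)))))))).1.
by move=> T; apply: T => /= B' y; rewrite !PT; split.
Qed.

Lemma internU X (A B : star N (set X)) x :
  intern (star2 setU A B) x <-> intern A x \/ intern B x.
Proof.
pose a' := v2 (set X) (set X) X [::]; pose b' := v1 (set X) X [:: (set X : Type)].
pose x' := v0 X [:: (set X : Type); (set X : Type)].
have := (transfer N (All (All (All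
 (And (Imp (Hd (App (f2 setU a' b') x'))
           (Or (Hd (App a' x')) (Hd (App b' x'))))
      (Imp (Or (Hd (App a' x')) (Hd (App b' x')))
           (Hd (App (f2 setU a' b') x')))))))).1.
by move=> T; apply: T => /= A1 B1 y; rewrite !PT; split.
Qed.

Lemma internD X (A B : star N (set X)) x :
  intern (star2 setD A B) x <-> intern A x /\ ~ intern B x.
Proof.
pose a' := v2 (set X) (set X) X [::]; pose b' := v1 (set X) X [:: (set X : Type)].
pose x' := v0 X [:: (set X : Type); (set X : Type)].
have := (transfer N (All (All (All
 (And (Imp (Hd (App (f2 setD a' b') x'))
           (And (Hd (App a' x')) (Not (Hd (App b' x')))))
      (Imp (And (Hd (App a' x')) (Not (Hd (App b' x'))))
           (Hd (App (f2 setD a' b') x')))))))).1.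
by move=> T; apply: T => /= A1 B1 y; rewrite !PT; split.
Qed.

Lemma holds_false : ~ holds (emb N False).
Proof.
have := (transfer N (Not (Hd (c [::] False)))).1.
by apply => /=; rewrite PT.
Qed.

Lemma holds_emb (P : Prop) : holds (emb N P) <-> P.
Proof.
split=> [|/propT ->//].
by have [/propT ->//|/propF ->] := pselect P; move=> /holds_false.
Qed.

Lemma star1_const X Z (a : Z) (x : star N X) :
  star1 (fun _ : X => a) x = emb N a.
Proof.
have := (transfer N (All (Eq (f1 (fun _ : X => a) (v0 X [::])) (c _ a)))).1.
exact.
Qed.

Lemma star1_emb X Z (f : X -> Z) (x : X) : star1 f (emb N x) = emb N (f x).
Proof.
have := (transfer N (Eq (f1 f (c [::] x)) (c _ (f x)))).1.
exact.
Qed.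

Lemma star1_neg X (P : set X) (x : star N X) :
  holds (star1 (fun t => ~ P t) x) <-> ~ holds (star1 P x).
Proof. by have := internC (emb N P) x; rewrite star1_emb. Qed.

Lemma star1_horn X (P Q S : set X) : (forall x, P x -> Q x -> S x) ->
  forall x : star N X, holds (star1 P x) -> holds (star1 Q x) ->
    holds (star1 S x).
Proof.
move=> H; have := (transfer N (All
   (Imp (Hd (f1 P (v0 X [::]))) (Imp (Hd (f1 Q (v0 X [::])))
     (Hd (f1 S (v0 X [::]))))))).1.
by apply => /= x; rewrite !PT; exact: H.
Qed.

Lemma star1_mono X (P Q : set X) : (forall x, P x -> Q x) ->
  forall x : star N X, holds (star1 P x) -> holds (star1 Q x).
Proof. by move=> H x Px; apply: (@star1_horn _ P P Q) => // t /H. Qed.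

Lemma star1_all X (P : set X) : (forall x, P x) ->
  forall x : star N X, holds (star1 P x).
Proof.
move=> H x; apply: (@star1_mono X setT P) => [y _|]; first exact: H.
exact: internT.
Qed.

Lemma star2_horn X Y Z (P : set X) (Q : set Y) (F : X -> Y -> Z) (T : set Z) :
  (forall x y, P x -> Q y -> T (F x y)) ->
  forall (x : star N X) (y : star N Y), holds (star1 P x) -> holds (star1 Q y) ->
    holds (star1 T (star2 F x y)).
Proof.
move=> H; have := (transfer N (All (All
   (Imp (Hd (f1 P (v1 X Y [::]))) (Imp (Hd (f1 Q (v0 Y _)))
     (Hd (f1 T (f2 F (v1 X Y [::]) (v0 Y _))))))))).1.
by move=> T'; apply: T' => /= x y; rewrite !PT; exact: H.
Qed.

Lemma star2_constr X Y Z (F : X -> Y -> Z) (y : Y) (x : star N X) :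
  star2 F x (emb N y) = star1 (F^~ y) x.
Proof.
have := (transfer N (All (Eq (f2 F (v0 X [::]) (c _ y))
  (f1 (F^~ y) (v0 X [::]))))).1.
exact.
Qed.

Lemma star1_comp X Y Z (g : Y -> Z) (f : X -> Y) (x : star N X) :
  star1 g (star1 f x) = star1 (g \o f) x.
Proof.
have := (transfer N (All (Eq (f1 g (f1 f (v0 X [::])))
  (f1 (g \o f) (v0 X [::]))))).1.
exact.
Qed.

Lemma intern_emb X (A : set X) (x : X) : intern (emb N A) (emb N x) <-> A x.
Proof. by rewrite internE -[app _ _]/(star1 A _) star1_emb holds_emb. Qed.

End transfer_lemmas.

Section real_st.
Variables (N : nonstandard_extension) (R : realType).

Definition star_lt (x y : star N R) : Prop :=
  holds (star2 (fun a b : R => is_true (a < b)) x y).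

Definition infinitesimal (x : star N R) : Prop :=
  forall e : R, 0 < e -> star_lt (star1 (fun a : R => `|a|) x) (emb N e).

Definition infinitely_close (x y : star N R) : Prop :=
  infinitesimal (star2 (fun a b : R => a - b) x y).

(* arbitrary unless [x] is finite *)
Definition st_real (x : star N R) : R :=
  get [set r : R | infinitely_close x (emb N r)].

Lemma infinitely_closeP x r : infinitely_close x (emb N r) <->
  forall e, 0 < e -> holds (star1 (fun a : R => is_true (`|a - r| < e)) x).
Proof.
rewrite /infinitely_close /infinitesimal /star_lt.
by split => H e /H; rewrite !star2_constr !star1_comp.
Qed.

Lemma infinitely_close_uniq x r s : infinitely_close x (emb N r) ->
  infinitely_close x (emb N s) -> r = s.
Proof.
move=> /infinitely_closeP xr /infinitely_closeP xs.
apply/eqP; rewrite eq_sym -subr_eq0 -normr_le0 leNgt; apply/negP => rs.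
have e0 : 0 < `|s - r| / 2 by rewrite divr_gt0.
apply: (@holds_false N); rewrite -(star1_const False x).
apply: star1_horn (xr _ e0) (xs _ e0) => y yr ys /=.
have := ltrD yr ys; rewrite -splitr ltNge => /negP; apply.
have -> : s - r = (y - r) - (y - s) by ring.
exact: ler_normB.
Qed.

Lemma st_realE x r : infinitely_close x (emb N r) -> st_real x = r.
Proof.
move=> xr; apply: (infinitely_close_uniq _ xr).
by rewrite /st_real; case: xgetP => [s _ //|/(_ r)].
Qed.

Lemma st_real_emb r : st_real (emb N r) = r.
Proof.
apply/st_realE/infinitely_closeP => e e0.
by rewrite star1_emb holds_emb subrr normr0.
Qed.

Lemma st_realP x : holds (star1 (fun a : R => is_true (0 <= a)) x) ->
  holds (star1 (fun a : R => is_true (a <= 1)) x) ->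
  infinitely_close x (emb N (st_real x)).
Proof.
move=> x0 x1; suff [r xr] : exists r, infinitely_close x (emb N r).
  by rewrite (st_realE xr).
pose D := [set s : R | holds (star1 (fun a : R => is_true (s <= a)) x)].
have supD : has_sup D.
  split; first by exists 0.
  exists 1 => s Ds; rewrite leNgt; apply/negP => s1.
  apply: (@holds_false N); rewrite -(star1_const False x).
  apply: star1_horn Ds x1 => y sy y1.
  by move: (le_trans sy y1); rewrite leNgt s1.
exists (sup D); apply/infinitely_closeP => e e0.
have [s Ds sD] := sup_adherent e0 supD.
have nD : ~ D (sup D + e / 2).
  move=> De; have := ub_le_sup supD.2 De.
  by rewrite gerDl leNgt divr_gt0.
have {}nD : holds (star1 (fun a => ~ is_true (sup D + e / 2 <= a)) x).
  exact/star1_neg.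
apply: star1_horn Ds nD => y sy /negP; rewrite -ltNge => yD.
rewrite ltr_norml ltrBlDr ltrBrDr.
by rewrite addrC (lt_le_trans sD sy)/= addrC (lt_trans yD)// ltrD2l ltr_pdivrMr// ltr_pMr// ltr1n.
Qed.

Lemma infinitely_closeD x y r s : infinitely_close x (emb N r) ->
  infinitely_close y (emb N s) ->
  infinitely_close (star2 (fun a b : R => a + b) x y) (emb N (r + s)).
Proof.
move=> /infinitely_closeP xr /infinitely_closeP ys.
apply/infinitely_closeP => e e0.
have e2 : 0 < e / 2 by rewrite divr_gt0.
apply: star2_horn (xr _ e2) (ys _ e2) => a b ar bs /=.
by rewrite opprD addrACA (le_lt_trans (ler_normD _ _))// [e]splitr ltrD.
Qed.

Lemma st_real_ge0 x : holds (star1 (fun a : R => is_true (0 <= a)) x) ->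
  holds (star1 (fun a : R => is_true (a <= 1)) x) -> 0 <= st_real x.
Proof.
move=> x0 x1; rewrite leNgt; apply/negP => r0.
have /infinitely_closeP xr := st_realP x0 x1.
rewrite -oppr_gt0 in r0.
apply: (@holds_false N); rewrite -(star1_const False x).
apply: star1_horn x0 (xr _ r0) => y y0.
rewrite ltNge => /negP; apply; rewrite ger0_norm ?lerDr//.
by rewrite addr_ge0// ltW.
Qed.

End real_st.

(* Measurable types are pointed; a space carrying a probability measure is
   nonempty anyway. *)
HB.structure Definition PointedMetric (R : numDomainType) :=
  { M of Metric R M & isPointed M }.
Notation pmetricType := PointedMetric.type.

Definition borel (R : realType) (Y : pmetricType R) : measurableType _ :=
  g_sigma_algebraType (@open Y).

Section loeb_content.
Variables (N : nonstandard_extension) (R : realType) (Y : pmetricType R).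
Local Notation M := (probability (borel Y) R).
Local Notation mY := (@measurable _ (borel Y)).

Definition star_borel : set (set (star N Y)) :=
  [set S | exists2 A : star N (set Y),
    intern (emb N mY) A & S = [set x | intern A x]].

Definition star_measure (Pi : star N M) (A : star N (set Y)) : star N R :=
  star2 (fun (P : M) (B : set Y) => fine (P B)) Pi A.

Lemma star_borel0 : star_borel set0.
Proof.
exists (emb N set0); last by apply/seteqP; split => // x /intern0.
by apply/intern_emb; exact: measurable0.
Qed.

Lemma star_borelU : setU_closed star_borel.
Proof.
move=> _ _ [A mA ->] [B mB ->]; exists (star2 setU A B).
  by apply: (@star2_horn N _ _ _ mY mY setU mY) mA mB => C D; exact: measurableU.
by apply/seteqP; split => x /internU.
Qed.

Lemma star_borelC : setC_closed star_borel.
Proof.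
move=> _ [A mA ->]; exists (star1 setC A).
  rewrite internE -[app _ _]/(star1 mY _) star1_comp.
  by apply: star1_mono mA => B; exact: measurableC.
by apply/seteqP; split => x /internC.
Qed.

(* The standard part of [Pi A], for the internal Borel set [A] (unique by
   [intern_ext]) whose set of points is [S]; [0] if there is none. *)
Definition loeb_content (Pi : star N M) (S : set (star N Y)) : \bar R :=
  (st_real (star_measure Pi (xget (emb N set0)
    [set A | intern (emb N mY) A /\ S = [set x | intern A x]])))%:E.

Lemma star_measure_ge0 Pi A :
  holds (star1 (fun a : R => is_true (0 <= a)) (star_measure Pi A)).
Proof.
apply: (@star2_horn N _ _ _ setT setT) => [P B _ _| |]; [|exact: internT..].
by rewrite fine_ge0.
Qed.

Lemma star_measure_le1 Pi A : intern (emb N mY) A ->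
  holds (star1 (fun a : R => is_true (a <= 1)) (star_measure Pi A)).
Proof.
move=> mA; apply: (@star2_horn N _ _ _ setT mY) mA; last exact: internT.
move=> P B _ mB; rewrite -lee_fin fineK ?probability_le1//.
exact: fin_num_measure.
Qed.

Lemma star_measure0 Pi : star_measure Pi (emb N set0) = emb N 0.
Proof.
rewrite /star_measure star2_constr.
rewrite (_ : (fun _ => _) = (fun=> 0)) ?star1_const//.
by apply/funext => P; rewrite measure0.
Qed.

Lemma star_measureU Pi A B : intern (emb N mY) A -> intern (emb N mY) B ->
  (forall x, ~ (intern A x /\ intern B x)) ->
  star_measure Pi (star2 setU A B) =
  star2 (fun a b : R => a + b) (star_measure Pi A) (star_measure Pi B).
Proof.
pose G : seq Type := [:: (set Y : Type); (set Y : Type); (M : Type)].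
pose b : term G (set Y) := Var (V0 _ _).
pose a : term G (set Y) := Var (VS _ (V0 _ _)).
pose P : term G M := Var (VS _ (VS _ (V0 _ _))).
pose G' : seq Type := (Y : Type) :: G.
pose y : term G' Y := Var (V0 _ _).
pose b' : term G' (set Y) := Var (VS _ (V0 _ _)).
pose a' : term G' (set Y) := Var (VS _ (VS _ (V0 _ _))).
pose m t := App (App (Cst G (fun (Q : M) (B : set Y) => fine (Q B))) P) t.
have := (transfer N (All (All (All (Imp (Eq (App (Cst G mY) a) (Cst _ True))
  (Imp (Eq (App (Cst G mY) b) (Cst _ True))
  (Imp (All (Not (And (Eq (App a' y) (Cst _ True)) (Eq (App b' y) (Cst _ True)))))
  (Eq (m (App (App (Cst G setU) a) b))
    (App (App (Cst G (fun a b : R => a + b)) (m a)) (m b)))))))))).1.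
move=> /= H mA mB AB; apply: H mA mB AB => P1 A1 B1; rewrite !PT => mA mB AB.
rewrite measureU ?fineD//; try exact: fin_num_measure.
by apply/seteqP; split => // t [At Bt]; apply: (AB t); rewrite !PT.
Qed.

Lemma loeb_contentE Pi A : intern (emb N mY) A ->
  loeb_content Pi [set x | intern A x] = (st_real (star_measure Pi A))%:E.
Proof.
move=> mA; rewrite /loeb_content; case: xgetP => [B _ [mB AB]|/(_ A)]; last first.
  by case.
congr (st_real (star_measure Pi _))%:E; apply: intern_ext => x.
by have := congr1 (fun S => S x) AB; rewrite /= => ->.
Qed.

Lemma loeb_content_ge0 Pi S : (0 <= loeb_content Pi S)%E.
Proof.
rewrite lee_fin; case: xgetP => [A _ [mA _]|_].
  by apply: st_real_ge0; [exact: star_measure_ge0|exact: star_measure_le1].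
by rewrite star_measure0 st_real_emb.
Qed.

Lemma loeb_content0 Pi : loeb_content Pi set0 = 0%E.
Proof.
rewrite (_ : set0 = [set x | intern (emb N set0) x]).
  rewrite loeb_contentE; last by apply/intern_emb; exact: measurable0.
  by rewrite star_measure0 st_real_emb.
by apply/seteqP; split => // x /intern0.
Qed.

Lemma loeb_contentU Pi S1 S2 : star_borel S1 -> star_borel S2 ->
  S1 `&` S2 = set0 ->
  loeb_content Pi (S1 `|` S2) = (loeb_content Pi S1 + loeb_content Pi S2)%E.
Proof.
move=> [A mA ->] [B mB ->] AB.
rewrite (_ : _ `|` _ = [set x | intern (star2 setU A B) x]); last first.
  by apply/seteqP; split => x /internU.
have mAB : intern (emb N mY) (star2 setU A B).
  by apply: (@star2_horn N _ _ _ mY mY setU mY) mA mB => C D; exact: measurableU.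
rewrite !loeb_contentE// star_measureU//; last first.
  by move=> x ABx; have : set0 x by rewrite -AB.
rewrite -EFinD; congr _%:E; apply: st_realE; apply: infinitely_closeD;
  by apply: st_realP; [exact: star_measure_ge0|exact: star_measure_le1].
Qed.

End loeb_content.

Definition loeb_display : Type -> measure_display. Proof. exact. Qed.

(* [*Y] with the algebra of internal Borel sets [*B_Y] *)
Definition star_space (N : nonstandard_extension) (R : realType)
  (Y : pmetricType R) : Type := star N Y.

Section loeb_measure.
Variables (N : nonstandard_extension) (R : realType) (Y : pmetricType R).
Local Notation M := (probability (borel Y) R).
Local Notation mY := (@measurable _ (borel Y)).

HB.instance Definition _ := Pointed.on (star_space N Y).
HB.instance Definition _ := isAlgebraOfSets.Build (loeb_display (star N Y))
  (star_space N Y) (@star_borel0 N R Y) (@star_borelU N R Y)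
  (@star_borelC N R Y).

Variable Pi : star N M.
Local Notation content := (loeb_content Pi : set (star_space N Y) -> \bar R).

Let loeb_content_semi_additive : measure_function.semi_additive content.
Proof. by apply/additive2P; [exact: loeb_content0|exact: loeb_contentU]. Qed.

HB.instance Definition _ := isContent.Build _ (star_space N Y) R content
  (loeb_content_ge0 Pi) loeb_content_semi_additive.

Let loeb_content_sigma_subadditive :
  measurable_subset_sigma_subadditive content.
Proof.
move=> A F mF mA AF.
have [n An] : exists n, A `<=` \big[setU/set0]_(i < n) F i.
  apply: contrapT => /forallNP H.
  have [A' mA' eA] := mA.
  have /choice[F' F'P] : forall i, exists B : star N (set Y),
      intern (emb N mY) B /\ F i = [set x | intern B x].
    by move=> i; have [B mB ->] := mF i; exists B.
  have [|x xP] := @saturation N Y (fun i => star2 setD A' (F' i)).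
    move=> n; have /existsNP[x] := H n.+1.
    move=> /not_implyP[Ax nFx]; exists x => i ni; apply/internD; split.
      by move: Ax; rewrite eA.
    move=> Fix; apply: nFx; rewrite -bigcup_mkord; exists i => //=.
    by rewrite (F'P i).2.
  have Ax : A x by rewrite eA; have /internD[] := xP 0%N.
  have [i _] := AF _ Ax; rewrite (F'P i).2 /=.
  by have /internD[] := xP i.
apply: (@le_trans _ _ (\sum_(i < n) content (F i))%E).
  by apply: content_subadditive => // i _; exact: mF.
rewrite -(big_mkord xpredT (content \o F)).
by apply: nneseries_lim_ge => i _ _; exact: loeb_content_ge0.
Qed.

HB.instance Definition _ := Content_SigmaSubAdditive_isMeasure.Build _ R
  (star_space N Y) content loeb_content_sigma_subadditive.

End loeb_measure.

Section completion.
Context d (T : semiRingOfSetsType d) (R : realType).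
Variable mu : {measure set T -> \bar R}.
Hypothesis mu_fin : forall A : set T, (mu^*%mu A < +oo)%E.
Local Open Scope ereal_scope.

Lemma measurable_hull (E : set T) : exists F, [/\ (d.-measurable).-sigma.-measurable F,
  E `<=` F & mu^*%mu F = mu^*%mu E].
Proof.
have /choice[A AP] : forall n, exists A, measurable_cover E A /\
    \sum_(0 <= k <oo) mu (A k) < mu^*%mu E + n.+1%:R^-1%:E.
  move=> n; have : mu^*%mu E \is a fin_num.
    by rewrite ge0_fin_numE ?mu_fin// mu_ext_ge0.
  have n0 : (0 < n.+1%:R^-1 :> R)%R by rewrite invr_gt0.
  by move/lb_ereal_inf_adherent => /(_ _ n0)[_/= [A EA] <-] ?; exists A.
pose F_ n := \bigcup_m (A n m).
have EF n : E `<=` F_ n by exact: cover_subset (AP n).1.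
exists (\bigcap_n F_ n); split.
- apply: bigcapT_measurable => k; apply: bigcupT_measurable => i.
  by apply: sub_sigma_algebra; exact: cover_measurable (AP k).1 i.
- exact: sub_bigcap.
apply/eqP; rewrite eq_le; apply/andP; split; last first.
  by apply: le_mu_ext => //; exact: sub_bigcap.
apply/lee_addgt0Pr => /= _/posnumP[e]; near \oo => n.
apply: (@le_trans _ _ (mu^*%mu (F_ n))).
  by apply: le_mu_ext => //; exact: bigcap_inf.
apply: (@le_trans _ _ (mu^*%mu E + n.+1%:R^-1%:E)); last first.
  by rewrite leeD2l// lee_fin ltW//; near: n; exact: near_infty_natSinv_lt.
apply: le_trans (ltW (AP n).2).
apply: (le_trans (outer_measure_sigma_subadditive mu^*%mu (A n))).
apply: lee_nneseries => // k _.
by rewrite -((measurable_mu_extE mu) (A n k))//; exact: cover_measurable (AP n).1 k.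
Unshelve. all: by end_near. Qed.

Lemma caratheodory_completion :
  mu^*%mu.-cara.-measurable = completed_algebra_gen (measure_extension mu).
Proof.
apply/seteqP; split=> [E mE|_ [A mA [N [B [mB B0 NB]] <-]]].
  have [G [mG EG muG]] := measurable_hull (~` E).
  have [H [mH GEH muH]] := measurable_hull (G `\` ~` E).
  have cG := @sub_caratheodory _ _ _ mu _ mG.
  have GE0 : mu^*%mu (G `\` ~` E) = 0.
    have := @measureD _ (caratheodory_type mu^*%mu) R
      (@completed_measure_extension _ _ _ mu) G (~` E) cG (measurableC mE)
      (mu_fin G).
    rewrite setIidr// => muGE; apply: (etrans muGE).
    rewrite /completed_measure_extension.
    have : (mu^*%mu G - mu^*%mu (~` E) = 0)%E.
      by rewrite muG subee// ge0_fin_numE ?mu_fin// mu_ext_ge0.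
    exact.
  exists (~` G); first exact: measurableC.
  exists (G `\` ~` E); first by exists H; split => //; rewrite -GE0 -muH.
  apply/seteqP; split=> [x [nG|[]]|x Ex].
  - by apply: contrapT => nE; exact/nG/EG.
  - by move=> _ /contrapT.
  - by have [Gx|] := pselect (G x); [right; split => // /(_ Ex)|left].
apply: measurableU; first exact: sub_caratheodory.
apply: (@measure_is_complete_caratheodory R T mu^*%mu).
by exists B; split => //; exact: sub_caratheodory.
Qed.

End completion.

Section standard_part.
Variables (N : nonstandard_extension) (R : realType) (Y : pmetricType R).

(* arbitrary at points that are not near-standard *)
Definition st (x : star N Y) : Y :=
  get [set y : Y | infinitesimal (star2 (@mdist R Y) x (emb N y))].

Lemma near_standardP x (y : Y) : infinitesimal (star2 (@mdist R Y) x (emb N y)) <->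
  forall e, 0 < e -> holds (star1 (fun t : Y => is_true (mdist t y < e)) x).
Proof.
rewrite /infinitesimal /star_lt.
have eE e : (fun t : Y => is_true (mdist t y < e)) =
    (fun t => is_true (`|mdist t y| < e)).
  by apply/funext => t; rewrite ger0_norm ?mdist_ge0.
by split => H e /H; rewrite !star2_constr !star1_comp eE.
Qed.

Hypothesis cY : compact [set: Y].

Lemma st_near x : infinitesimal (star2 (@mdist R Y) x (emb N (st x))).
Proof.
suff [y xy] : exists y : Y, infinitesimal (star2 (@mdist R Y) x (emb N y)).
  by rewrite /st; case: xgetP => [z _ //|/(_ y)].
apply: contrapT => /forallNP H.
have /choice[e eP] : forall y : Y, exists e : R, 0 < e /\
    ~ holds (star1 (fun t : Y => is_true (mdist t y < e)) x).
  move=> y; apply: contrapT => /forallNP Hy; apply: (H y).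
  apply/near_standardP => e e0; apply: contrapT => He; exact: (Hy e).
have := cY; rewrite compact_cover => /(_ Y setT (fun y => (ball y (e y))^°)).
case.
- by move=> y _; exact: open_interior.
- move=> y _; exists y => //; apply: nbhsx_ballx; exact: (eP y).1.
move=> D _ Dcov.
have : holds (star1 (fun t : Y => exists2 y, y \in D & is_true (mdist t y < e y)) x).
  apply: star1_all => t; have [//|y /= yD] := Dcov t.
  move=> /interior_subset; rewrite ballEmdist /= => yt; exists y => //.
  by rewrite metric_sym.
have -> : (fun t : Y => exists2 y, y \in D & is_true (mdist t y < e y)) =
   (fun t => exists2 y, y \in (D : seq Y) & is_true (mdist t y < e y)) by [].
elim: (D : seq Y) => [|y s IHs].
  rewrite (_ : (fun _ => _) = (fun=> False)).
    by rewrite star1_const; exact: holds_false.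
  by apply/funext => t; rewrite propeqE; split => // -[].
move=> Hx; apply: IHs.
have ny : holds (star1 (fun t : Y => ~ is_true (mdist t y < e y)) x).
  by apply/star1_neg; exact: (eP y).2.
apply: star1_horn Hx ny => t [z]; rewrite inE => /predU1P[->//|zs zt _].
by exists z.
Qed.

Lemma st_preimage_closed (C : set Y) : closed C ->
  st @^-1` C = \bigcap_n [set x : star N Y | intern (emb N
    (\bigcup_(c in C) [set t | mdist t c < n.+1%:R^-1])) x].
Proof.
move=> cC; apply/seteqP; split => x /=.
- move=> Cx n _ /=.
  have n0 : 0 < n.+1%:R^-1 :> R by rewrite invr_gt0.
  have /near_standardP/(_ _ n0) := st_near x.
  by apply: star1_mono => t xt; exists (st x).
- move=> H; apply: cC => B /nbhs_ballP[e /= e0 eB].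
  have e2 : 0 < e / 2 by rewrite divr_gt0.
  have [n ne] : exists n, n.+1%:R^-1 < e / 2.
    by have [n _ /(_ n (leqnn n))] := near_infty_natSinv_lt (PosNum e2); exists n.
  have /near_standardP/(_ _ e2) xs := st_near x.
  have {}H : holds (star1 _ x) := H n I.
  apply: contrapT => /forallNP CB; apply: (@holds_false N).
  rewrite -(star1_const False x); apply: star1_horn xs H => t ts [c Cc /= tc].
  apply: (CB c); split => //; apply: eB; rewrite ballEmdist /=.
  rewrite (le_lt_trans (metric_triangle _ t _))// [e]splitr ltrD//.
    by rewrite metric_sym.
  exact: lt_trans tc ne.
Qed.

End standard_part.

Section pushdown.
Variables (N : nonstandard_extension) (R : realType) (Y : pmetricType R).
Local Notation M := (probability (borel Y) R).
Variable Pi : star N M.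

Let pi : {measure set (star_space N Y) -> \bar R} := loeb_content Pi.

(* The sigma-algebra is the completion of the one generated by [*B_Y], see
   [loeb_completion]. *)
Definition loeb_space : measurableType _ := caratheodory_type (pi^*)%mu.

Definition loeb_measure : set loeb_space -> \bar R :=
  @completed_measure_extension _ _ _ pi.

HB.instance Definition _ := Measure.on loeb_measure.

Lemma loeb_measureT : loeb_measure [set: star N Y] = 1%E.
Proof.
rewrite /loeb_measure /= /completed_measure_extension measurable_mu_extE//=.
rewrite (_ : setT = [set x | intern (emb N [set: Y]) x]); last first.
  by apply/seteqP; split => // x _; exact: internT.
rewrite loeb_contentE; last by apply/intern_emb; exact: measurableT.
rewrite /star_measure star2_constr.
rewrite (_ : (fun _ => _) = (fun=> 1)) ?star1_const ?st_real_emb//.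
by apply/funext => P; rewrite probability_setT.
Qed.

Lemma measurable_st : compact [set: Y] ->
  measurable_fun [set: loeb_space] (@st N R Y : loeb_space -> borel Y).
Proof.
move=> cY; apply: (@measurability _ _ loeb_space (borel Y) setT (@st N R Y) (@open Y)) => //.
move=> _ [U openU <-]; rewrite setTI -[U]setCK preimage_setC.
apply: measurableC.
have E := @st_preimage_closed N R Y cY _ (open_closedC openU).
apply: (eq_ind_r (fun S : set loeb_space => measurable S) _ E).
apply: bigcapT_measurable => n; apply: caratheodory_measurable_mu_ext.
eexists; last by [].
apply/intern_emb; apply: sub_sigma_algebra; apply: bigcup_open => c _.
rewrite openE => t /= tc; apply/nbhs_ballP.
exists (n.+1%:R^-1 - mdist t c) => /=; first by rewrite subr_gt0.
move=> s; rewrite ballEmdist /= => ts.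
rewrite (le_lt_trans (metric_triangle _ t _))// -ltrBrDr.
by rewrite metric_sym.
Qed.

Lemma loeb_completion : @measurable _ loeb_space =
  completed_algebra_gen (measure_extension pi).
Proof.
apply: caratheodory_completion => A; apply: (@le_lt_trans _ _ 1%E).
  by rewrite -loeb_measureT; exact: le_mu_ext.
exact: ltry.
Qed.

HB.instance Definition _ :=
  Measure_isProbability.Build _ _ _ loeb_measure loeb_measureT.

Variable cY : compact [set: Y].

Definition st_mfun : {mfun loeb_space >-> borel Y} :=
  HB.pack (@st N R Y : loeb_space -> borel Y)
    (isMeasurableFun.Build _ _ _ _ _ (measurable_st cY)).

Definition pushdown : M := distribution loeb_measure st_mfun.

End pushdown.

Section wasserstein.
Variables (R : realType) (Y : pmetricType R).
Local Notation M := (probability (borel Y) R).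

(* A [probability] is a function on all subsets, whose values are meaningful
   on measurable sets only. *)
Definition couplings (mu nu : M) :
    set (probability (borel Y * borel Y)%type R) :=
  [set kappa | forall A, measurable A ->
    kappa (A `*` setT) = mu A /\ kappa (setT `*` A) = nu A].

Definition wasserstein (mu nu : M) : R :=
  inf [set \int[kappa]_xy mdist (xy.1 : Y) (xy.2 : Y) | kappa in couplings mu nu].

End wasserstein.

(* Main.v *)
Require Import Defs.
From HB Require Import structures.
From mathcomp Require Import all_boot all_order all_algebra.
From mathcomp Require Import ring lra finmap.
From mathcomp Require Import all_classical all_reals all_analysis.
From mathcomp Require Import measurable_realfun.
Set Implicit Arguments.
Unset Strict Implicit.
Unset Printing Implicit Defensive.
Import Order.TTheory GRing.Theory Num.Theory.
Import numFieldNormedType.Exports.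

Local Open Scope classical_set_scope.
Local Open Scope ring_scope.

(* Fix e > 0. Since Y is compact and the spheres around a point are disjoint,
   there are finitely many balls of radius about e that cover Y and whose
   boundary spheres have small mass for nu, the push-down of Pi; cutting them
   apart gives disjoint open sets U_i of small diameter that carry almost all
   the mass of nu. For U open, st^-1(U) is contained in *U, so nu(U) is at most
   the standard part of Pi( *U), whence t nu(U_i) <= Pi( *U_i) for any standard
   t < 1. By transfer it remains to see that these finitely many inequalities
   make the Wasserstein distance small for a standard measure mu: the mass
   t nu(U_i) can be transported inside U_i, and little mass is left. *)

Section density.
Context d (T : measurableType d) (R : realType).
Local Open Scope ereal_scope.

Lemma density_probability (mu : {measure set T -> \bar R}) (f : T -> \bar R) :
  measurable_fun [set: T] f -> (forall x, 0 <= f x) -> \int[mu]_x f x = 1 ->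
  exists kappa : probability T R,
    forall A, measurable A -> kappa A = \int[mu]_(x in A) f x.
Proof.
move=> mf f0 f1; pose k A := \int[mu]_(x in A) f x.
have k0 : k set0 = 0 by rewrite /k integral_set0.
have k_ge0 A : 0 <= k A by exact: integral_ge0.
have k_additive : semi_sigma_additive k.
  move=> F mF tF mUF; rewrite /k ge0_integral_bigcup//; last first.
    exact: measurable_funTS.
  by apply: is_cvg_ereal_nneg_natsum_cond => n _ _; exact: integral_ge0.
pose km := isMeasure.Build _ T R k k0 k_ge0 k_additive.
pose kM : {measure set T -> \bar R} := HB.pack k km.
pose kp := Measure_isProbability.Build _ T R kM f1.
pose kP : probability T R := HB.pack (kM : set T -> \bar R) kM kp.
by exists kP.
Qed.

Lemma integral_affine_indic (P : probability T R) (I : finType)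
    (U : I -> set T) (a : R) (b : I -> R) : (forall i, measurable (U i)) ->
  \int[P]_y (a + \sum_i b i * \1_(U i) y)%:E =
  (a + \sum_i b i * fine (P (U i)))%:E.
Proof.
move=> mU.
have iU i : P.-integrable setT (fun y => (b i * \1_(U i) y)%:E).
  under eq_fun do rewrite EFinM.
  by apply: integrableZl => //; exact: integrable_indic.
under eq_integral do rewrite EFinD -sumEFin.
rewrite integralD//; last 2 first.
- exact: finite_measure_integrable_cst.
- exact: integrable_sum.
rewrite integral_cst// [X in _ * X](probability_setT P) mule1 EFinD.
congr (_ + _).
rewrite integral_sum// -sumEFin; apply: eq_bigr => i _.
under eq_integral do rewrite EFinM.
rewrite integralZl ?integral_indic ?setIT//; last exact: integrable_indic.
by rewrite EFinM fineK// fin_num_measure.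
Qed.

End density.

Section coupling.
Context d1 d2 (T1 : measurableType d1) (T2 : measurableType d2) (R : realType).
Variables (mu : probability T1 R) (nu : probability T2 R).
Local Open Scope ereal_scope.

Lemma density_coupling (f : T1 * T2 -> \bar R) :
  measurable_fun [set: T1 * T2] f -> (forall z, 0 <= f z) ->
  (forall x, \int[nu]_y f (x, y) = 1) -> (forall y, \int[mu]_x f (x, y) = 1) ->
  exists2 kappa : probability (T1 * T2)%type R,
    (forall A, measurable A -> kappa (A `*` setT) = mu A) /\
    (forall A, measurable A -> kappa (setT `*` A) = nu A) &
    forall A, measurable A -> kappa A = \int[mu \x nu]_(z in A) f z.
Proof.
move=> mf f0 f1 f2.
have [|kappa kappaE] := @density_probability _ _ _ (mu \x nu)%E f mf f0.
  rewrite fubini_tonelli1//; under eq_integral do rewrite /fubini_F f1.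
  by rewrite integral_cst// mul1e; exact: probability_setT.
exists kappa => //; split=> A mA.
- have mAT : measurable (A `*` [set: T2]) by exact: measurableX.
  rewrite kappaE// integral_mkcond fubini_tonelli1//; first last.
  + by move=> z; exact: erestrict_ge0.
  + by apply/(measurable_restrictT _ _).1 => //; exact: measurable_funTS.
  rewrite -[RHS]mul1e -integral_cst//.
  rewrite [RHS]integral_mkcond; apply: eq_integral => x _.
  rewrite /fubini_F /patch; case: ifPn => xA.
    rewrite -[RHS](f1 x); apply: eq_integral => y _.
    by rewrite ifT// inE; split => //; rewrite inE in xA.
  rewrite integral0_eq// => y _; rewrite ifF//; apply/negP.
  by rewrite inE => -[/= /mem_set]; rewrite (negbTE xA).
- have mAT : measurable ([set: T1] `*` A) by exact: measurableX.
  rewrite kappaE// integral_mkcond fubini_tonelli1//; first last.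
  + by move=> z; exact: erestrict_ge0.
  + by apply/(measurable_restrictT _ _).1 => //; exact: measurable_funTS.
  rewrite fubini_tonelli//; first last.
  + by move=> z; exact: erestrict_ge0.
  + by apply/(measurable_restrictT _ _).1 => //; exact: measurable_funTS.
  rewrite -[RHS]mul1e -integral_cst//.
  rewrite [RHS]integral_mkcond; apply: eq_integral => y _.
  rewrite /patch; case: ifPn => yA.
    rewrite -[RHS](f2 y); apply: eq_integral => x _.
    by rewrite ifT// inE; split => //; rewrite inE in yA.
  rewrite integral0_eq// => x _; rewrite ifF//; apply/negP.
  by rewrite inE => -[_ /= /mem_set]; rewrite (negbTE yA).
Qed.

End coupling.

Section block_density.
Context d (T : measurableType d) (R : realType) (I : finType) (U : I -> set T).
Hypothesis mU : forall i, measurable (U i).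
Hypothesis tU : forall i j x, U i x -> U j x -> i = j.

Definition residual (m p : I -> R) (x : T) : R :=
  1 - \sum_i m i / p i * \1_(U i) x.

(* The density, with respect to the product of two probabilities giving [U i]
   the masses [p i] and [q i], of the coupling that transports the mass [m i]
   inside [U i] and takes the independent coupling of what remains. *)
Definition block_density (m p q : I -> R) (x y : T) : R :=
  \sum_i m i / (p i * q i) * (\1_(U i) x * \1_(U i) y) +
  (1 - \sum_i m i)^-1 * (residual m p x * residual m q y).

Lemma block_densityC m p q x y :
  block_density m p q x y = block_density m q p y x.
Proof.
rewrite /block_density [residual m p x * _]mulrC; congr (_ + _).
by apply: eq_bigr => i _; rewrite (mulrC (p i)) (mulrC (\1_(U i) x)).
Qed.

Lemma residual_ge0 m p x : (forall i, 0 <= m i) -> (forall i, m i <= p i) ->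
  0 <= residual m p x.
Proof.
move=> m0 mp; rewrite subr_ge0; have [[i Uix]|nU] := pselect (exists i, U i x).
  rewrite (bigD1 i)//= big1 => [|j ji].
    rewrite addr0 indicE mem_set// mulr1.
    have [p0|p0] := eqVneq (p i) 0; first by rewrite p0 invr0 mulr0.
    by rewrite ler_pdivrMr ?mul1r// lt0r p0 (le_trans (m0 i)).
  rewrite indicE memNset ?mulr0// => Ujx.
  by rewrite (tU Ujx Uix) eqxx in ji.
rewrite big1// => i _; rewrite indicE memNset ?mulr0// => Uix.
by apply: nU; exists i.
Qed.

Lemma block_density_ge0 m p q x y : (forall i, 0 <= m i) ->
  (forall i, m i <= p i) -> (forall i, m i <= q i) -> \sum_i m i < 1 ->
  0 <= block_density m p q x y.
Proof.
move=> m0 mp mq m1; rewrite addr_ge0//.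
  apply: sumr_ge0 => i _.
  by rewrite mulr_ge0// divr_ge0// mulr_ge0// (le_trans (m0 i)).
by rewrite mulr_ge0 ?mulr_ge0 ?residual_ge0// invr_ge0 subr_ge0 ltW.
Qed.

Lemma measurable_residual m p : measurable_fun [set: T] (residual m p).
Proof.
apply: measurable_funB => //; apply: measurable_sum => i.
by apply: measurable_funM => //; exact: measurable_indic.
Qed.

Lemma measurable_block_density m p q :
  measurable_fun [set: T * T] (fun z => block_density m p q z.1 z.2).
Proof.
apply: measurable_funD; [apply: measurable_sum => i|];
    apply: measurable_funM => //; apply: measurable_funM;
    apply: measurableT_comp => //; solve
  [exact: measurable_indic | exact: measurable_residual
  | exact: measurable_fst | exact: measurable_snd].
Qed.

Variable nu : probability T R.
Let q i := fine (nu (U i)).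

Lemma integral_residual m : (forall i, 0 <= m i) -> (forall i, m i <= q i) ->
  (\int[nu]_y (residual m q y)%:E = (1 - \sum_i m i)%:E)%E.
Proof.
move=> m0 mq; under eq_integral do rewrite /residual -sumrN.
under eq_integral do under eq_bigr do rewrite -mulNr.
rewrite integral_affine_indic// -sumrN; congr (1 + _)%:E; apply: eq_bigr => i _.
rewrite -/(q i); have [q0|q0] := eqVneq (q i) 0; last by rewrite mulNr divfK.
by rewrite q0 mulr0; apply/esym/eqP; rewrite oppr_eq0 eq_le m0 andbT -q0.
Qed.

Lemma integral_block_density m p x : (forall i, 0 <= m i) ->
  (forall i, m i <= q i) -> \sum_i m i < 1 ->
  (\int[nu]_y (block_density m p q x y)%:E = 1)%E.
Proof.
move=> m0 mq m1; pose a := (1 - \sum_i m i)^-1 * residual m p x.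
rewrite (eq_integral (fun y => (a + \sum_i
    (m i / (p i * q i) * \1_(U i) x - a * (m i / q i)) * \1_(U i) y)%:E));
  last first.
  move=> y _; congr EFin; rewrite /block_density mulrA -/a /residual.
  rewrite mulrBr mulr1 addrCA; congr (a + _).
  rewrite mulr_sumr -sumrB; apply: eq_bigr => i _; ring.
rewrite integral_affine_indic//; congr EFin.
have mqE i : m i / q i * q i = m i.
  have [q0|q0] := eqVneq (q i) 0; last by rewrite divfK.
  by rewrite q0 mulr0; apply/esym/eqP; rewrite eq_le m0 andbT -q0.
rewrite (eq_bigr (fun i => m i / p i * \1_(U i) x - a * m i)) => [|i _].
  rewrite sumrB -mulr_sumr addrCA -[X in _ + (X - _)]mulr1 -mulrBr mulrAC.
  by rewrite mulVf ?mul1r ?subr_eq0 1?gt_eqF// /residual addrC subrK.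
rewrite -/(q i) -[in RHS](mqE i) mulrBl invfM; ring.
Qed.

End block_density.

Section block_coupling.
Context d (T : measurableType d) (R : realType) (I : finType) (U : I -> set T).
Hypothesis mU : forall i, measurable (U i).
Hypothesis tU : forall i j x, U i x -> U j x -> i = j.
Variables (mu nu : probability T R) (m : I -> R).
Hypothesis m0 : forall i, 0 <= m i.
Hypothesis m_mu : forall i, m i <= fine (mu (U i)).
Hypothesis m_nu : forall i, m i <= fine (nu (U i)).
Hypothesis m1 : \sum_i m i < 1.

Lemma block_coupling : exists2 kappa : probability (T * T)%type R,
  (forall A, measurable A -> kappa (A `*` setT) = mu A) /\
  (forall A, measurable A -> kappa (setT `*` A) = nu A) &
  (kappa (~` \bigcup_i (U i `*` U i)) <= (1 - \sum_i m i)%:E)%E.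
Proof.
pose p i := fine (mu (U i)); pose q i := fine (nu (U i)).
pose f z := (block_density U m p q z.1 z.2)%:E.
have mf : measurable_fun [set: T * T] f.
  by apply/measurable_EFinP; exact: measurable_block_density.
have f0 z : (0 <= f z)%E by rewrite lee_fin; exact: block_density_ge0.
have [x|y|kappa kappaP kappaE] := density_coupling mf f0 (mu := mu) (nu := nu).
- exact: integral_block_density.
- under eq_integral do rewrite /f block_densityC.
  exact: integral_block_density.
exists kappa => //; set V := \bigcup_i _.
have mV : measurable V.
  by apply: fin_bigcup_measurable => // i _; exact: measurableX.
rewrite kappaE; last exact: measurableC.
pose rho := (1 - \sum_i m i)^-1.
have rho0 : 0 <= rho by rewrite invr_ge0 subr_ge0 ltW.
pose h z := (rho * (residual U m p z.1 * residual U m q z.2))%:E.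
have h0 z : (0 <= h z)%E.
  by rewrite lee_fin mulr_ge0// mulr_ge0//; exact: residual_ge0.
have mh : measurable_fun [set: T * T] h.
  apply/measurable_EFinP; apply: measurable_funM => //; apply: measurable_funM.
    by apply: measurableT_comp => //; exact: measurable_residual.
  by apply: measurableT_comp => //; exact: measurable_residual.
apply: (@le_trans _ _ (\int[mu \x nu]_z h z)%E).
  rewrite integral_mkcond; apply: ge0_le_integral => //.
  - by move=> z _; exact: erestrict_ge0.
  - apply/(measurable_restrictT _ _).1; first exact: measurableC.
    exact: measurable_funTS.
  move=> z _; rewrite /patch; case: ifPn => // /set_mem Vz.
  rewrite lee_fin /block_density big1 ?add0r// => i _.
  have [Uz1|nUz1] := pselect (U i z.1); last first.
    by rewrite indicE memNset// mul0r mulr0.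
  have [Uz2|nUz2] := pselect (U i z.2); last first.
    by rewrite (mulrC (\1_(U i) z.1)) indicE memNset// mul0r mulr0.
  by exfalso; apply: Vz; exists i.
rewrite fubini_tonelli1// /fubini_F /h/=.
under eq_integral => x _.
  under eq_integral => y _ do rewrite mulrA EFinM.
  rewrite ge0_integralZl_EFin//; last 3 first.
  - by move=> y _; rewrite lee_fin; exact: residual_ge0.
  - by apply/measurable_EFinP; exact: measurable_residual.
  - by rewrite mulr_ge0//; exact: residual_ge0.
  rewrite integral_residual// -EFinM mulrAC mulVf ?mul1r; last first.
    by rewrite subr_eq0 gt_eqF.
  over.
by rewrite integral_residual.
Qed.

End block_coupling.

Section ge0_le_integral_nonmeasurable.
Context d (T : measurableType d) (R : realType).
Variable mu : {measure set T -> \bar R}.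
Local Open Scope ereal_scope.

(* Unlike [ge0_le_integral], no measurability: the integral of a nonnegative
   function is a supremum over the simple functions below it. *)
Lemma ge0_le_integralT (f g : T -> \bar R) : (forall x, 0 <= f x) ->
  (forall x, f x <= g x) -> \int[mu]_x f x <= \int[mu]_x g x.
Proof.
move=> f0 fg; rewrite !ge0_integralTE//; last first.
  by move=> x; exact: le_trans (fg x).
apply: ereal_sup_le => _ [h hf <-]; exists h => // x.
exact: le_trans (hf x) (fg x).
Qed.

End ge0_le_integral_nonmeasurable.

Lemma trivIset_small d (T : measurableType d) (R : realType)
    (P : probability T R) (F : nat -> set T) (e : R) :
  (forall k, measurable (F k)) -> trivIset setT F -> 0 < e ->
  exists k, (P (F k) < e%:E)%E.
Proof.
move=> mF tF e0; apply: contrapT => /forallNP PF.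
have eP k : (e%:E <= P (F k))%E by rewrite leNgt; apply/negP/PF.
have := archi_boundP (ltW (divr_gt0 ltr01 e0)).
set K := Num.bound _; rewrite ltr_pdivrMr// ltNge => /negP; apply.
rewrite -lee_fin.
have mU : measurable (\big[setU/set0]_(i < K) F i) by exact: bigsetU_measurable.
apply: le_trans (probability_le1 P mU).
rewrite measure_semi_additive//.
rewrite mulr_natl -[X in _ *+ X]card_ord -sumr_const -sumEFin.
apply: lee_sum => k _; exact: eP.
Qed.

Section metric.
Context (R : realType) (Y : pmetricType R).
Local Notation M := (probability (borel Y) R).

Lemma open_mdist_lt (y : Y) (r : R) : open [set x | mdist y x < r].
Proof.
rewrite openE => t /= yt; apply/nbhs_ballP.
exists (r - mdist y t) => /=; first by rewrite subr_gt0.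
move=> s; rewrite ballEmdist /= => ts.
by rewrite (le_lt_trans (metric_triangle _ t _))// -ltrBrDl.
Qed.

Lemma open_mdist_gt (y : Y) (r : R) : open [set x | r < mdist y x].
Proof.
rewrite openE => t /= yt; apply/nbhs_ballP.
exists (mdist y t - r) => /=; first by rewrite subr_gt0.
move=> s; rewrite ballEmdist /= ltrBrDr -ltrBrDl => ts.
by rewrite (lt_le_trans ts)// lerBlDr (metric_sym t) metric_triangle.
Qed.

Lemma closed_mdist_le (y : Y) (r : R) : closed [set x | mdist y x <= r].
Proof.
rewrite (_ : [set _ | _] = ~` [set x | r < mdist y x]).
  exact/open_closedC/open_mdist_gt.
by apply/seteqP; split => x /=; rewrite leNgt => /negP.
Qed.

Lemma open_borel (U : set Y) : open U -> measurable (U : set (borel Y)).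
Proof. exact: sub_sigma_algebra. Qed.

Lemma measurable_sphere (y : Y) (r : R) :
  measurable ([set x | mdist y x = r] : set (borel Y)).
Proof.
rewrite (_ : [set _ | _] =
    ~` ([set x | mdist y x < r] `|` [set x | r < mdist y x])).
  apply: measurableC; apply: measurableU; apply: open_borel.
    exact: open_mdist_lt.
  exact: open_mdist_gt.
apply/seteqP; split => x /=; first by move=> ->; rewrite ltxx => -[].
by move/not_orP => -[/negP + /negP]; case: ltgtP.
Qed.

Lemma small_sphere (P : M) (y : Y) (e delta : R) : 0 < e -> 0 < delta ->
  exists r, e <= r <= 2 * e /\ (P [set x | mdist y x = r] < delta%:E)%E.
Proof.
move=> e0 d0; pose r (k : nat) := e + e / k.+1%:R.
have [|i j _ _ [x [/= -> rij]]|k Pk] := @trivIset_small _ _ _ P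
  (fun k => [set x | mdist y x = r k]) delta _ _ d0.
- by move=> k; exact: measurable_sphere.
- move: rij => /addrI /(mulfI (lt0r_neq0 e0)) /invr_inj /eqP.
  by rewrite eqr_nat => /eqP[].
exists (r k); split => //; rewrite /r lerDl divr_ge0 ?(ltW e0)//=.
by rewrite mulr_natl mulr2n lerD2l ler_pdivrMr// ler_peMr ?(ltW e0)// ler1n.
Qed.

Hypothesis cY : compact [set: Y].

Lemma finite_ball_cover (e : R) : 0 < e ->
  exists s : seq Y, forall x, exists2 y, y \in s & mdist y x < e.
Proof.
move=> e0; have := cY; rewrite compact_cover.
move=> /(_ Y setT (fun y => [set x | mdist y x < e])) [||D _ Dcov].
- by move=> y _; exact: open_mdist_lt.
- by move=> y _; exists y => //=; rewrite mdistxx.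
- by exists D => x; have [//|y /= yD yx] := Dcov x; exists y.
Qed.

Lemma compact_mdist_le : exists D : R, forall x y : Y, mdist x y <= D.
Proof.
have [s sP] := finite_ball_cover ltr01.
pose S := \sum_(y <- s) mdist point y.
have dS (x : Y) : mdist point x <= S + 1.
  have [y ys yx] := sP x.
  rewrite (le_trans (metric_triangle _ y _))// lerD ?(ltW yx)//.
  rewrite /S (big_rem y)//= lerDl sumr_ge0// => z _; exact: mdist_ge0.
exists ((S + 1) + (S + 1)) => x y; apply: le_trans (lerD (dS x) (dS y)).
by rewrite (metric_sym point x) metric_triangle.
Qed.

Lemma disjoint_open_family (P : M) (e delta : R) : 0 < e -> 0 < delta ->
  exists n (U : 'I_n -> set Y), [/\ forall i, open (U i),
    forall i j x, U i x -> U j x -> i = j,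
    forall i x y, U i x -> U i y -> mdist x y <= e &
    1 - delta <= \sum_i fine (P (U i))].
Proof.
move=> e0 d0; have e4 : 0 < e / 4 by rewrite divr_gt0.
have [s sP] := finite_ball_cover e4.
pose c i := nth point s i.
have d's : 0 < delta / (size s).+1%:R by rewrite divr_gt0.
have /choice[r rP] := fun i => small_sphere P (c i) e4 d's.
pose U i := [set x | mdist (c i) x < r i] `&`
  ~` (\bigcup_(j in `I_i) [set x | mdist (c j) x <= r j]).
pose S i := [set x | mdist (c i) x = r i].
have oU i : open (U i).
  apply: openI; first exact: open_mdist_lt.
  apply: closed_openC; apply: closed_bigcup => // j _; exact: closed_mdist_le.
have tU i j x : (i < j)%N -> U i x -> U j x -> False.
  by move=> ij [Uix _] [_]; apply; exists i => //=; exact: ltW.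
have mU i : measurable (U i : set (borel Y)) by exact: open_borel.
have mS i : measurable (S i : set (borel Y)) by exact: measurable_sphere.
exists (size s), U; split => //.
- move=> i j x Uix Ujx; apply: val_inj.
  by case: (ltngtP i j) => // /tU; [case/(_ x)|case/(_ x)].
- move=> i x y [/= xi _] [/= yi _].
  rewrite (le_trans (metric_triangle _ (c i) _))// metric_sym.
  have [/andP[_ ri] _] := rP i.
  rewrite (le_trans (lerD (ltW xi) (ltW yi)))// (le_trans (lerD ri ri))//.
  lra.
have cov : [set: borel Y] `<=` \big[setU/set0]_(i < size s) (U i `|` S i).
  move=> x _; rewrite -(bigcup_mkord _ (fun i => U i `|` S i)).
  have ex : exists i, (i < size s)%N && (mdist (c i) x <= r i).
    have [y ys yx] := sP x; exists (index y s); rewrite index_mem ys /=.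
    have [/andP[ri _] _] := rP (index y s).
    by rewrite /c nth_index// (le_trans (ltW yx)).
  have [i /andP[is_ xi] mini] := ex_minnP ex.
  move: xi; rewrite le_eqVlt => /predU1P[xi|xi]; exists i => //; first by right.
  left; split=> // -[j /= ji xj]; have := mini j; rewrite xj.
  by rewrite (ltn_trans ji is_) => /(_ isT); rewrite leqNgt ji.
have PS i : (P (U i `|` S i) <= (fine (P (U i)) + delta / (size s).+1%:R)%:E)%E.
  rewrite EFinD fineK ?fin_num_measure// (le_trans (measureU2 _ _ _))//.
  by rewrite leeD2l// ltW// (rP i).2.
rewrite lerBlDr -lee_fin -(probability_setT P).
apply: (@le_trans _ _ (\sum_(i < size s) P (U i `|` S i))%E).
  apply: (@content_subadditive _ _ _ P _ (fun i => U i `|` S i)) => // i _.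
  exact: measurableU.
apply: (@le_trans _ _
  (\sum_(i < size s) (fine (P (U i)) + delta / (size s).+1%:R)%:E)%E).
  by apply: lee_sum => i _; exact: PS.
rewrite sumEFin lee_fin big_split/= lerD2l sumr_const card_ord.
by rewrite -[leLHS]mulr_natr mulrAC ler_pdivrMr// ler_wpM2l ?(ltW d0)// ler_nat.
Qed.

End metric.

Section wasserstein_bounds.
Context (R : realType) (Y : pmetricType R).
Local Notation M := (probability (borel Y) R).

Lemma wasserstein_set_ge0 (mu nu : M) : lbound
  [set \int[kappa]_xy mdist (xy.1 : Y) (xy.2 : Y) | kappa in couplings mu nu] 0.
Proof.
by move=> _ [kappa _ <-]; apply: Rintegral_ge0 => *; exact: mdist_ge0.
Qed.

Lemma wasserstein_ge0 (mu nu : M) : 0 <= wasserstein mu nu.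
Proof.
rewrite /wasserstein; set A := [set _ | _ in _].
have [->|/set0P A0] := eqVneq A set0; first by rewrite inf0.
by apply: lb_le_inf => //; exact: wasserstein_set_ge0.
Qed.

Lemma wasserstein_le_block (mu nu : M) (I : finType) (U : I -> set Y)
    (m : I -> R) (e D : R) :
  0 <= e -> (forall i, open (U i)) ->
  (forall i j x, U i x -> U j x -> i = j) ->
  (forall i x y, U i x -> U i y -> mdist x y <= e) ->
  (forall x y : Y, mdist x y <= D) ->
  (forall i, 0 <= m i) -> (forall i, m i <= fine (mu (U i))) ->
  (forall i, m i <= fine (nu (U i))) -> \sum_i m i < 1 ->
  wasserstein mu nu <= e + D * (1 - \sum_i m i).
Proof.
move=> e0 oU tU Ue YD m0 m_mu m_nu m1.
have mU i : measurable (U i : set (borel Y)) by exact: open_borel.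
have [kappa [k1 k2]] := block_coupling mU tU m0 m_mu m_nu m1.
set V := \bigcup_i _ => kV.
have mV : measurable V.
  by apply: fin_bigcup_measurable => // i _; exact: measurableX.
have mVC := measurableC mV.
have D0 : 0 <= D by exact: le_trans (mdist_ge0 point point) (YD _ _).
have Ckappa : couplings mu nu kappa.
  by move=> A mA; split; [exact: k1|exact: k2].
apply: (@le_trans _ _ (\int[kappa]_xy mdist (xy.1 : Y) (xy.2 : Y))).
  by apply: ge_inf; [exists 0; exact: wasserstein_set_ge0|exists kappa].
pose g (z : borel Y * borel Y) : \bar R := (e%:E + D%:E * (\1_(~` V) z)%:E)%E.
have Ig : (\int[kappa]_z g z = e%:E + D%:E * kappa (~` V))%E.
  rewrite ge0_integralD//; last 2 first.
  - by move=> z _; rewrite mule_ge0// lee_fin.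
  - by apply: measurable_funeM; apply/measurable_EFinP; exact: measurable_indic.
  rewrite integral_cst// [X in (_ * X)%E](probability_setT kappa) mule1.
  rewrite ge0_integralZl_EFin//; last first.
    by apply/measurable_EFinP; exact: measurable_indic.
  by rewrite integral_indic// setIT.
have g_le : (\int[kappa]_z g z <= (e + D * (1 - \sum_i m i))%:E)%E.
  by rewrite Ig EFinD EFinM leeD2l// lee_wpmul2l// lee_fin.
rewrite -lee_fin (le_trans _ g_le)// /Rintegral.
have d_le : (\int[kappa]_z (mdist (z.1 : Y) (z.2 : Y))%:E <=
    \int[kappa]_z g z)%E.
  apply: ge0_le_integralT => z; first by rewrite lee_fin mdist_ge0.
  rewrite /g -EFinM -EFinD lee_fin indicE.
  have [[i _ [/= U1 U2]]|nV] := pselect (V z).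
    by rewrite (le_trans (Ue i _ _ U1 U2))// lerDl mulr_ge0.
  by rewrite mem_set// mulr1 (le_trans (YD _ _))// lerDr.
rewrite fineK// ge0_fin_numE.
  by rewrite (le_lt_trans d_le)// (le_lt_trans g_le)// ltry.
by apply: integral_ge0 => z _; rewrite lee_fin mdist_ge0.
Qed.

(* Convergence on finitely many open sets controls the Wasserstein distance,
   as in the portmanteau theorem. *)
Lemma wasserstein_lt_open_sets (cY : compact [set: Y]) (nu : M) (e : R) :
  0 < e -> exists n (U : 'I_n -> set Y) (t : R), [/\ t < 1,
    forall i, open (U i) & forall mu : M,
    (forall i, t * fine (nu (U i)) <= fine (mu (U i))) ->
    wasserstein mu nu < e].
Proof.
move=> e0; have [D YD] := compact_mdist_le cY.
have D0 : 0 <= D by exact: le_trans (mdist_ge0 point point) (YD _ _).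
pose delta := Num.min (1 / 2) (e / 8 / (D + 1)).
have D1 : 0 < D + 1 by rewrite ltr_wpDl.
have d0 : 0 < delta by rewrite lt_min !divr_gt0.
have d2 : delta <= 1 / 2 by rewrite ge_min lexx.
have dD : D * delta <= e / 8.
  have : delta <= e / 8 / (D + 1) by rewrite ge_min lexx orbT.
  rewrite ler_pdivlMr// mulrDr mulr1 => h.
  by rewrite mulrC (le_trans _ h)// lerDl ltW.
have e2 : 0 < e / 2 by rewrite divr_gt0.
have [n [U [oU tU Ue nuU]]] := disjoint_open_family cY nu e2 d0.
have mU i : measurable (U i : set (borel Y)) by exact: open_borel.
exists n, U, (1 - delta); split => //; first by rewrite ltrBlDr ltrDl.
move=> mu muU; set t := 1 - delta in muU.
have nu0 i : 0 <= fine (nu (U i)) by rewrite fine_ge0.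
have nu1 : \sum_i fine (nu (U i)) <= 1.
  have mUU : measurable (\big[setU/set0]_(i < n) (U i : set (borel Y))).
    exact: bigsetU_measurable.
  rewrite -lee_fin -sumEFin (le_trans _ (probability_le1 nu mUU))//.
  rewrite measure_semi_additive_ord//.
    by apply: lee_sum => i _; rewrite fineK// fin_num_measure.
  by move=> i j _ _ [x [Ui Uj]]; exact: tU Ui Uj.
have t0 : 0 <= t by rewrite /t; lra.
have t1 : t < 1 by rewrite /t; lra.
have sE : \sum_i t * fine (nu (U i)) = t * \sum_i fine (nu (U i)).
  by rewrite mulr_sumr.
apply: (@le_lt_trans _ _ (e / 2 + D * (1 - \sum_i t * fine (nu (U i))))).
  apply: wasserstein_le_block => //; first exact: ltW.
  - by move=> i; rewrite mulr_ge0.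
  - by move=> i; rewrite ler_piMl// ltW.
  - by rewrite sE (le_lt_trans _ t1)// ler_piMr.
set s := \sum_i fine _ in nuU nu1 sE; rewrite sE.
have : D * (1 - t * s) <= D * (2 * delta).
  by rewrite ler_wpM2l//; move: nuU; rewrite /t => nuU; nra.
by nra.
Qed.

End wasserstein_bounds.

Section star_pushdown.
Variable N : nonstandard_extension.

Lemma star1_forall_ord X n (P : 'I_n -> set X) (x : star N X) :
  (forall i, holds (star1 (P i) x)) ->
  holds (star1 (fun t => forall i, P i t) x).
Proof.
move=> Px; suff : forall s : seq 'I_n,
    holds (star1 (fun t => forall i, i \in s -> P i t) x).
  move=> /(_ (enum 'I_n)); apply: star1_mono => t Pt i.
  by apply: Pt; rewrite mem_enum.
elim=> [|i s IHs]; first exact: star1_all.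
apply: star1_horn (Px i) IHs => t Pit Pst j.
by rewrite inE => /predU1P[->|/Pst].
Qed.

Variables (R : realType) (Y : pmetricType R) (cY : compact [set: Y]).
Local Notation M := (probability (borel Y) R).

Lemma st_preimage_open (U : set Y) : open U ->
  @st N R Y @^-1` U `<=` [set x | intern (emb N U) x].
Proof.
move=> oU x /= Ux; have : nbhs (st x) U by exact: open_nbhs_nbhs.
move=> /nbhs_ballP[e /= e0 eU].
have /near_standardP/(_ _ e0) := st_near cY x; apply: star1_mono => t ts.
by apply: eU; rewrite ballEmdist /= metric_sym.
Qed.

Lemma pushdown_open_le (Pi : star N M) (U : set Y) : open U ->
  fine (pushdown Pi cY U) <= st_real (star_measure Pi (emb N U)).
Proof.
move=> oU; have mU : intern (emb N (@measurable _ (borel Y))) (emb N U).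
  by apply/intern_emb; exact: open_borel.
rewrite -lee_fin fineK; last exact: fin_num_measure (open_borel oU).
rewrite -loeb_contentE//.
have sb : measurable ([set x | intern (emb N U) x] : set (star_space N Y)).
  by exists (emb N U).
rewrite -[leRHS](measurable_mu_extE (loeb_content Pi) sb).
by apply: le_mu_ext; exact: st_preimage_open.
Qed.

Lemma star_measure_open_ge (Pi : star N M) (U : set Y) (t : R) :
  open U -> t < 1 ->
  holds (star1 (fun mu : M => is_true
    (t * fine (pushdown Pi cY U) <= fine (mu U))) Pi).
Proof.
move=> oU t1; set q := fine _.
have q0 : 0 <= q by rewrite fine_ge0.
have [->|qn0] := eqVneq q 0.
  by apply: star1_all => mu; rewrite mulr0 fine_ge0.
have mU : intern (emb N (@measurable _ (borel Y))) (emb N U).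
  by apply/intern_emb; exact: open_borel.
have d0 : 0 < (1 - t) * q by rewrite mulr_gt0 ?subr_gt0// lt0r qn0.
have /infinitely_closeP/(_ _ d0) :=
  st_realP (star_measure_ge0 Pi (emb N U)) (star_measure_le1 Pi mU).
rewrite {2}/star_measure star2_constr star1_comp.
apply: star1_mono => mu /=; rewrite ltr_norml => /andP[h _].
have := pushdown_open_le Pi oU; rewrite -/q => h2.
by move: h; set s := st_real _ in h2 *; nra.
Qed.

End star_pushdown.

Theorem theorem9 (N : nonstandard_extension) (R : realType)
    (Y : pmetricType R) (cY : compact [set: Y])
    (Pi : star N (probability (borel Y) R)) :
  infinitesimal (star2 (@wasserstein R Y) Pi (emb N (pushdown Pi cY))).
Proof.
move=> e e0; rewrite /star_lt !star2_constr !star1_comp.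
have [n [U [t [t1 oU WU]]]] := wasserstein_lt_open_sets cY (pushdown Pi cY) e0.
have : holds (star1 (fun mu : probability (borel Y) R => forall i,
    is_true (t * fine (pushdown Pi cY (U i)) <= fine (mu (U i)))) Pi).
  by apply: star1_forall_ord => i; exact: star_measure_open_ge.
by apply: star1_mono => mu /WU; rewrite /= ger0_norm ?wasserstein_ge0.
Qed.
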